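(* There is no strongly anti-coproximinal subspace in the real space $\ell_1^n$; that is, for every positive integer $n$, no proper linear subspace $\mathbb{Y}$ of $\ell_1^n$ with $\dim \mathbb{Y} > 1$ is strongly anti-coproximinal in $\ell_1^n$.
   Context: Let $\mathbb{Y}$ be a subspace of a real Banach space $\mathbb{X}$. For $\epsilon \in [0,1)$ and $x, y \in \mathbb{X}$, $x \perp_B^{\epsilon} y$ means $\|x + \lambda y\|^2 \ge \|x\|^2 - 2\epsilon \|x\| \|\lambda y\|$ for all $\lambda \in \mathbb{R}$ (it is known that this is equivalent to $\|x+\lambda y\| \ge \|x\| - \epsilon\|\lambda y\|$ for all $\lambda \in \mathbb{R}$). An element $y_0 \in \mathbb{Y}$ is an $\epsilon$-best coapproximation to $x$ out of $\mathbb{Y}$ if $y \perp_B^{\epsilon} (x - y_0)$ for all $y \in \mathbb{Y}$. $\mathbb{Y}$ is a strongly anti-coproximinal subspace of $\mathbb{X}$ if for every $x \in \mathbb{X} \setminus \mathbb{Y}$ and every $\epsilon \in [0,1)$ there does not exist any $\epsilon$-best coapproximation to $x$ out of $\mathbb{Y}$. *)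

(* Defs.v *)
From HB Require Import structures.
From mathcomp Require Import all_boot all_order all_algebra.
From mathcomp Require Import all_classical all_reals all_analysis.

Set Implicit Arguments.
Unset Strict Implicit.
Unset Printing Implicit Defensive.

Import Order.TTheory GRing.Theory Num.Theory.
Import numFieldNormedType.Exports.

Local Open Scope classical_set_scope.
Local Open Scope ring_scope.

(* An alias is needed because 'rV[R]_n already carries the sup norm. *)
Definition l1 (R : realType) (n : nat) : Type := 'rV[R]_n.

HB.instance Definition _ (R : realType) (n : nat) :=
  Vector.copy (l1 R n) 'rV[R]_n.

Section L1.
Variables (R : realType) (n : nat).
Implicit Types x y : l1 R n.

Definition l1_norm x : R := \sum_(i < n) `|x ord0 i|.

Lemma ler_l1_normD x y : l1_norm (x + y) <= l1_norm x + l1_norm y.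
Proof.
by rewrite -big_split; apply: ler_sum => i _; rewrite mxE ler_normD.
Qed.

Lemma l1_normZ (a : R) x : l1_norm (a *: x) = `|a| * l1_norm x.
Proof. by rewrite mulr_sumr; apply: eq_bigr => i _; rewrite mxE normrM. Qed.

Lemma l1_norm0_eq0 x : l1_norm x = 0 -> x = 0.
Proof.
move=> /eqP; rewrite psumr_eq0 // => /allP x0; apply/rowP => i.
by rewrite mxE; apply/eqP; rewrite -normr_eq0; apply: x0; rewrite mem_index_enum.
Qed.

HB.instance Definition _ :=
  @Lmodule_isNormed.Build R (l1 R n) l1_norm ler_l1_normD l1_normZ l1_norm0_eq0.

Lemma l1_normE x : `|x| = \sum_(i < n) `|x ord0 i|.
Proof. by []. Qed.

Lemma l1_complete (F : set_system (l1 R n)) : ProperFilter F -> cauchy F -> cvg F.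
Proof.
move=> FF /cauchy_ballP Fc.
have /(_ _)/cauchy_cvg cvF i : cauchy ((fun x : l1 R n => x ord0 i) @ F).
  apply/cauchy_ballP => e e0; rewrite near_map2.
  apply: filterS (Fc e e0) => -[x y]; rewrite -!ball_normE /= => h.
  apply: le_lt_trans h; rewrite l1_normE (bigD1 i) //= !mxE lerDl.
  exact: sumr_ge0.
apply/cvg_ex; exists (\row_i (lim ((fun x : l1 R n => x ord0 i) @ F) : R)).
apply/cvgrPdist_lt => e e0.
have d0 : 0 < e / n.+1%:R by rewrite divr_gt0.
have /filter_forall : forall i, \forall x \near F,
    `|lim ((fun x : l1 R n => x ord0 i) @ F) - (x : l1 R n) ord0 i| < e / n.+1%:R.
  by move=> i; move/cvgrPdist_lt: (cvF i) => /(_ _ d0).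
apply: filterS => x Hx; rewrite l1_normE.
apply: (@le_lt_trans _ _ (\sum_(i < n) e / n.+1%:R)).
  by apply: ler_sum => i _; rewrite !mxE; exact: ltW.
by rewrite sumr_const card_ord -[X in X < _]mulr_natr mulrAC ltr_pdivrMr // ltr_pM2l // ltr_nat.
Qed.

HB.instance Definition _ := Uniform_isComplete.Build (l1 R n) l1_complete.
End L1.

Section Coapproximation.
Variables (R : realType) (X : completeNormedModType R).
Implicit Types (eps : R) (x y : X) (Y : {pred X}).

(* [bj_orthogonal eps x y] is the relation of approximate Birkhoff-James
   orthogonality of x to y; it is meant for 0 <= eps < 1. *)
Definition bj_orthogonal eps x y : Prop :=
  forall lambda : R,
    `|x| ^+ 2 - 2 * eps * `|x| * `|lambda *: y| <= `|x + lambda *: y| ^+ 2.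

Definition best_coapproximation eps Y x (y0 : X) : Prop :=
  y0 \in Y /\ forall y, y \in Y -> bj_orthogonal eps y (x - y0).

(* Y is meant to be the carrier of a linear subspace; for Y = X the property
   holds vacuously. *)
Definition strongly_anti_coproximinal Y : Prop :=
  forall x, x \notin Y -> forall eps, 0 <= eps < 1 ->
    ~ exists y0, best_coapproximation eps Y x y0.
End Coapproximation.

(* Main.v *)
Require Import Defs.
From mathcomp Require Import all_boot all_order all_algebra.
From mathcomp Require Import all_classical all_reals all_analysis.
From mathcomp Require Import lra.

(** Let g be a nonzero vector of coefficients of a linear form vanishing on Y,
    and let z be its vector of signs, so that z is not in Y.  For y in Y and
    any lambda, the products (lambda y_i) g_i sum to 0, hence y_i and
    lambda z_i do not have opposite signs for some i with z_i <> 0.  At this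
    coordinate |y_i + lambda z_i| >= |y_i|, while elsewhere at most
    |lambda z_j| is lost; this gives
    |y + lambda z| >= |y| - |lambda| (|z| - 1), and 0 is a (1 - 1/n)-best
    coapproximation to z because |z| <= n. *)

Set Implicit Arguments.
Unset Strict Implicit.
Unset Printing Implicit Defensive.

Import Order.TTheory GRing.Theory Num.Theory.
Import numFieldNormedType.Exports.

Local Open Scope ring_scope.

(** The map [f], identity minus projection onto [Y], kills [Y] but not [v]. Some coordinate [k] of
    [f] is thus a nonzero linear form vanishing on [Y], and [g] lists its values on the standard
    basis. *)
Lemma vspace_annihilator (F : fieldType) (n : nat) (Y : {vspace 'rV[F]_n}) :
  Y != fullv ->
  exists2 g : 'rV[F]_n, g != 0 &
    forall y, y \in Y -> \sum_(i < n) y ord0 i * g ord0 i = 0.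
Proof.
move=> Yproper; have [v vY] : exists v, v \notin Y.
  apply: contrapT => h; case/negP: Yproper; rewrite eqEsubv subvf /=.
  by apply/subvP => u _; apply/negPn/negP => uY; apply: h; exists u.
pose f (x : 'rV[F]_n) := x - projv Y x.
have fE x k : f x ord0 k =
    \sum_(i < n) x ord0 i * f (delta_mx ord0 i) ord0 k.
  rewrite /f {1 2}[x]row_sum_delta linear_sum -sumrB summxE.
  by apply: eq_bigr => i _; rewrite linearZ -scalerBr mxE.
have /rV0Pn[k fvk] : f v != 0.
  apply: contraNneq vY => /eqP; rewrite subr_eq0 => /eqP ->.
  exact: memv_proj.
exists (\row_i f (delta_mx ord0 i) ord0 k).
  apply: contraNneq fvk => /rowP g0; rewrite fE big1 // => i _.
  by have := g0 i; rewrite !mxE => ->; rewrite mulr0.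
move=> y yY; under eq_bigr do rewrite mxE.
by rewrite -fE /f projv_id // subrr mxE.
Qed.

Lemma bj_orthogonal_of_ge (R : realType) (X : completeNormedModType R)
    (eps : R) (x y : X) :
  (forall lambda : R, `|x| - eps * `|lambda *: y| <= `|x + lambda *: y|) ->
  bj_orthogonal eps x y.
Proof.
move=> h lambda; have := h lambda; have := normr_ge0 (x + lambda *: y).
have := normr_ge0 x.
move: `|x| `|lambda *: y| `|x + lambda *: y| => a t b a0 b0 hb.
have [le_ta|lt_at] := leP (eps * t) a.
  have : (a - eps * t) ^+ 2 <= b ^+ 2 by rewrite ler_sqr ?nnegrE // subr_ge0.
  by apply: le_trans; have := sqr_ge0 (eps * t); nra.
(* Here [a < eps * t], so the left side [a * (a - 2 * eps * t)] is at most 0. *)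
by apply: le_trans (sqr_ge0 b); nra.
Qed.

(** Otherwise every term with [g] nonzero is negative; there is at least one, so the sum could not
    vanish. *)
Lemma exists_same_sign (R : realDomainType) (n : nat) (a g : 'rV[R]_n) :
  g != 0 -> \sum_(i < n) a ord0 i * g ord0 i = 0 ->
  exists2 i, g ord0 i != 0 & 0 <= a ord0 i * g ord0 i.
Proof.
move=> /rV0Pn[k gk] sum0; apply: contrapT => h.
have neg i : g ord0 i != 0 -> a ord0 i * g ord0 i < 0.
  by move=> gi; rewrite ltNge; apply/negP => ?; apply: h; exists i.
have : \sum_(i < n) a ord0 i * g ord0 i < 0.
  rewrite (bigD1 k) //= ltr_wnDr ?neg // sumr_le0 // => i _.
  by have [->|/neg/ltW//] := eqVneq (g ord0 i) 0; rewrite mulr0.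
by rewrite sum0 ltxx.
Qed.

Lemma ler_l1_normD_same_sign (R : realType) (n : nat) (y w : l1 R n) (i : 'I_n) :
  0 <= y ord0 i * w ord0 i ->
  `|y| - (`|w| - `|w ord0 i|) <= `|y + w|.
Proof.
move=> yw; rewrite !l1_normE.
rewrite (bigD1 i) //= [X in _ - (X - _)](bigD1 i) //= [leRHS](bigD1 i) //=.
rewrite [X in _ - X]addrAC subrr add0r -addrA lerD //.
  (* After squaring, what remains is [0 <= 2 * y_i * w_i + w_i ^+ 2]. *)
  rewrite mxE -ler_sqr ?nnegrE // !real_normK ?num_real //.
  by have := sqr_ge0 (w ord0 i); nra.
rewrite -sumrB; apply: ler_sum => j _; rewrite mxE.
exact: lerB_normD.
Qed.

Section SignVector.
Variables (R : realType) (n : nat).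
Implicit Types g y : l1 R n.

Definition sign_vector g : l1 R n := \row_i Num.sg (g ord0 i).

Lemma l1_norm_sign_vector_le g : `|sign_vector g| <= n%:R.
Proof.
rewrite l1_normE -[leRHS]mulr1 mulr_natl -[X in _ *+ X]card_ord -sumr_const.
by apply: ler_sum => i _; rewrite mxE normr_sg; case: (_ == _).
Qed.

Lemma bj_orthogonal_sign_vector g y :
  g != 0 -> \sum_(i < n) y ord0 i * g ord0 i = 0 ->
  bj_orthogonal (1 - n%:R^-1) y (sign_vector g).
Proof.
move=> g0 yg; apply: bj_orthogonal_of_ge => lambda.
have [i gi yi] : exists2 i, g ord0 i != 0 &
    0 <= (lambda *: y) ord0 i * g ord0 i.
  apply: exists_same_sign => //; under eq_bigr do rewrite mxE -mulrA.
  by rewrite -mulr_sumr yg mulr0.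
have n0 : (0 < n)%N by case: (n) i {gi yi} => [[]|].
have same_sign : 0 <= y ord0 i * (lambda *: sign_vector g) ord0 i.
  (* Write [g_i] as its sign times its absolute value, and cancel the positive factor [|g_i|]. *)
  rewrite !mxE; move: yi; rewrite mxE {1}[g ord0 i]numEsg mulrA.
  by rewrite pmulr_lge0 ?normr_gt0 // mulrCA mulrA.
apply: le_trans (ler_l1_normD_same_sign same_sign).
(* With z the sign vector, [|z_i| = 1], so the claim reduces to [|lambda| * |z| / n <= |lambda|]. *)
rewrite !mxE normrM normr_sg gi mulr1 normrZ lerD2l lerN2.
rewrite mulrBl mul1r lerD2l lerN2 mulrCA ler_piMr // mulrC.
by rewrite ler_pdivrMr ?ltr0n // mul1r l1_norm_sign_vector_le.
Qed.

(** At its own sign vector the form [g] takes the value [|g|], which is nonzero. *)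
Lemma sign_vector_notin g (Y : {vspace l1 R n}) :
  g != 0 -> (forall y, y \in Y -> \sum_(i < n) y ord0 i * g ord0 i = 0) ->
  sign_vector g \notin Y.
Proof.
move=> g0 annY; apply/negP => /annY.
under eq_bigr do rewrite mxE -normrEsg.
by move=> /(@l1_norm0_eq0 R n) /eqP; apply/negP.
Qed.

End SignVector.

Theorem theorem2p34 (R : realType) (n : nat) (hn : (0 < n)%N)
    (Y : {vspace l1 R n}) (dimY : (1 < \dim Y)%N) (properY : Y != fullv) :
  ~ strongly_anti_coproximinal Y.
Proof.
have [g g0 annY] := vspace_annihilator properY.
move=> /(_ (sign_vector g) (sign_vector_notin g0 annY) (1 - n%:R^-1)); apply.
  by rewrite subr_ge0 gtrBl invr_gt0 ltr0n hn invf_le1 ?ltr0n // ler1n hn.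
exists 0; split=> [|y yY]; first exact: mem0v.
by rewrite subr0; apply: bj_orthogonal_sign_vector => //; exact: annY.
Qed.
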